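(* Let $(X,d)$ be a complete metric space and $(Y,\varrho)$ be a linear metric space with a translation-invariant metric. Let $\kappa>0$ and $\ell>0$ be constants such that $\kappa\ell<1$, let $\Omega\subset X\times Y$ be a non-empty set, let $\gamma:X\to[0,\infty]$ be a function which is both positive and Lipschitz continuous on $\Omega_X$ with the constant $1$, let $F:X\rightrightarrows Y$ be a set-valued mapping with a closed graph, and let $g:X\to Y$ be a single-valued mapping which is continuous on $X$. Assume that the set $$W:=\big\{(x,y)\in X\times Y:\ B_X(x,\gamma(x))\times B_Y(y-g(x),\ell\gamma(x))\subset\Omega\big\}$$ is such that $\operatorname{dom}F\cap W_X$ is non-empty. If $F$ is $\gamma$-regular on $\Omega$ with the constant $\kappa$ and $g$ is Lipschitz continuous on $\Omega_X$ with the constant $\ell$, then $F+g$ is $\gamma$-regular on $W$ with any constant $\hat\kappa>\kappa/(1-\kappa\ell)$.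
   Context: Vector spaces are real. For a set $W\subset X\times Y$, $W_X:=\{x\in X:\ (x,y)\in W\text{ for some }y\in Y\}$ (similarly $\Omega_X$). $B_X(x,r)=\{u: d(u,x)<r\}$ denotes the open ball; $B_X(x,\infty)=X$. For $F:X\rightrightarrows Y$: $\operatorname{dom}F=\{x:F(x)\ne\emptyset\}$, $F^{-1}(y)=\{x: y\in F(x)\}$, $(F+g)(x)=F(x)+g(x)$. Convention: $\inf\emptyset=\infty$, so the distance of a point to the empty set is $\infty$. Since $\gamma$ may take the value $\infty$, its Lipschitz continuity with constant $1$ on $\Omega_X$ is understood as $\gamma(x)\le\gamma(u)+d(x,u)$ for all $x,u\in\Omega_X$. For a set $W\subset X\times Y$, a constant $\kappa>0$ and $\gamma:X\to[0,\infty]$, a mapping $F:X\rightrightarrows Y$ is $\gamma$-regular on $W$ with the constant $\kappa$ if $\operatorname{dist}(x,F^{-1}(y))\le\kappa\operatorname{dist}(y,F(x))$ for each $(x,y)\in W$ with $\kappa\operatorname{dist}(y,F(x))<\gamma(x)$. *)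

(* Defs.v *)
From HB Require Import structures.
From mathcomp Require Import all_boot all_order all_algebra.
From mathcomp Require Import all_classical all_reals all_analysis.

Set Implicit Arguments.
Unset Strict Implicit.
Unset Printing Implicit Defensive.
Import Order.TTheory GRing.Theory Num.Theory.
Local Open Scope classical_set_scope.
Local Open Scope ring_scope.

#[short(type="completeMetricType")]
HB.structure Definition CompleteMetric (R : numDomainType) :=
  {M of Complete M & Metric R M}.

(* A linear metric space is a topological vector space whose topology comes
   from a metric. The hierarchy has no join of [Metric] with [GRing.Lmodule]
   and none can be added below [PseudoMetricNormedZmod], so the metric is
   put on top of [TopologicalLmodule]. The library's [tvsType] would be too
   strong, as it requires local convexity. *)
HB.mixin Record TopologicalLmodule_isLinearMetric (R : numDomainType) M
    & TopologicalLmodule R M := {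
  ldist : M -> M -> R ;
  ldistxx : forall x, ldist x x = 0 ;
  ldist_positivity : forall x y, ldist x y = 0 -> x = y ;
  ldist_sym : forall x y, ldist x y = ldist y x ;
  ldist_triangle : forall y x z, ldist x z <= ldist x y + ldist y z ;
  nbhs_ldist : forall (x : M) (A : set M),
    nbhs x A <-> exists2 e : R, 0 < e & [set y | ldist x y < e] `<=` A
}.

#[short(type="linearMetricType")]
HB.structure Definition LinearMetric (R : numDomainType) :=
  {M of TopologicalLmodule R M & TopologicalLmodule_isLinearMetric R M}.

(* The metric-dependent notions take the distance function as an argument:
   it is [mdist] in a [metricType] and [ldist] in a [linearMetricType]. *)
Section Metric_notions.
Context {R : realType} {T : Type} (d : T -> T -> R).

(* The radius may be [+oo], in which case the ball is the whole space. *)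
Definition open_eball (x : T) (r : \bar R) : set T :=
  [set u | ((d u x)%:E < r)%E].

(* This is [+oo] when [A] is empty. *)
Definition dist_set (x : T) (A : set T) : \bar R :=
  ereal_inf [set (d x a)%:E | a in A].

(* One-sided, hence meaningful for infinite values: if [gamma] is infinite
   somewhere on [A] then it is infinite everywhere on [A]. *)
Definition elipschitz1_on (A : set T) (gamma : T -> \bar R) : Prop :=
  forall x u, A x -> A u -> (gamma x <= gamma u + (d x u)%:E)%E.

End Metric_notions.

Definition lipschitz_const_on {R : realType} {X Y : Type}
    (dX : X -> X -> R) (dY : Y -> Y -> R)
    (A : set X) (l : R) (g : X -> Y) : Prop :=
  forall x u, A x -> A u -> dY (g x) (g u) <= l * dX x u.

Section Set_valued_mappings.
Context {X Y : Type}.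
Implicit Types F : X -> set Y.

Definition map_dom F : set X := [set x | F x !=set0].

Definition map_inv F (y : Y) : set X := [set x | F x y].

Definition map_graph F : set (X * Y) := [set p | F p.1 p.2].

End Set_valued_mappings.

Definition map_add {X : Type} {Y : zmodType} (F : X -> set Y) (g : X -> Y)
  : X -> set Y := fun x => [set v + g x | v in F x].

Definition gamma_regular {R : realType} {X Y : Type}
    (dX : X -> X -> R) (dY : Y -> Y -> R) (gamma : X -> \bar R)
    (F : X -> set Y) (W : set (X * Y)) (kappa : R) : Prop :=
  forall x y, W (x, y) ->
    (kappa%:E * dist_set dY y (F x) < gamma x)%E ->
    (dist_set dX x (map_inv F y) <= kappa%:E * dist_set dY y (F x))%E.

(* Main.v *)
Require Import Defs.
From HB Require Import structures.
From mathcomp Require Import all_boot all_order all_algebra.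
From mathcomp Require Import all_classical all_reals all_analysis.
From mathcomp Require Import ring lra.

Set Implicit Arguments.
Unset Strict Implicit.
Unset Printing Implicit Defensive.
Import Order.TTheory GRing.Theory Num.Theory.
Import numFieldNormedType.Exports.
Local Open Scope classical_set_scope.
Local Open Scope ring_scope.

(* Let D be the distance from y to (F + g)(x), which by translation invariance
   is the distance from y - g x to F x, and let kappa' * D < c < gamma x. Put
   q = kappa' l / (1 + kappa' l), so that 1 - q = 1 / (1 + kappa' l). A
   Lyusternik-Graves iteration starting at x picks u_(n+1) in
   F^-1(y - g u_n) within (1 - q) c q^n of u_n: regularity of F allows the
   step because kappa (1 + kappa' l) < kappa', and the Lipschitz property of g
   bounds the next residual by q times the bound on the current one. The
   iterates stay within c of x, hence in the region where regularity applies,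
   and their limit p satisfies y - g p \in F p. Working with a number c
   strictly above kappa' * D covers D = 0 as well; letting c decrease to
   kappa' * D gives the estimate. *)

(** Each step bound telescopes, since [(1 - q) * c * q ^+ n] equals [c * q ^+ n - c * q ^+ n.+1];
    the tail from [n] on thus has length at most [c * q ^+ n]. *)
Lemma geometric_mdist_cvg (R : realType) (X : completeMetricType R)
    (u : nat -> X) (c q : R) : 0 <= c -> 0 <= q -> q < 1 ->
  (forall n, mdist (u n) (u n.+1) <= (1 - q) * c * q ^+ n) ->
  exists2 p, u @ \oo --> p & forall n, mdist (u n) p <= c * q ^+ n.
Proof.
move=> c0 q0 q1 ustep.
have tele n k : mdist (u n) (u (n + k)%N) <= c * q ^+ n - c * q ^+ (n + k).
  elim: k => [|k IH]; first by rewrite addn0 subrr mdistxx.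
  rewrite addnS (le_trans (metric_triangle _ (u (n + k)%N) _))//.
  have := ustep (n + k)%N; rewrite exprS; lra.
have udist n m : (n <= m)%N -> mdist (u n) (u m) <= c * q ^+ n.
  move=> nm; rewrite -(subnKC nm) (le_trans (tele _ _))//.
  by rewrite gerBl mulr_ge0// exprn_ge0.
have small (e : R) : 0 < e -> exists n, c * q ^+ n < e.
  move=> e0; have : geometric c q @ \oo --> (0 : R).
    by apply: cvg_geometric; rewrite ger0_norm.
  move/cvgr0_norm_lt => /(_ _ e0)[n _ /(_ n (leqnn n))] /= H.
  by exists n; exact: le_lt_trans (ler_norm _) H.
have : cvg (u @ \oo).
  apply: cauchy_cvg; apply: cauchy_exP => e e0.
  have [n cn] := small e e0; exists (u n); exists n => // m /= nm.
  by rewrite ballEmdist /=; exact: le_lt_trans (udist _ _ nm) cn.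
move/cvg_ex => [p up]; exists p => // n.
apply/ler_addgt0Pr => e e0.
have [m _ /(_ (maxn m n) (leq_maxl _ _))] := cvg_ball up e0.
rewrite /= ballEmdist /= metric_sym => pm.
rewrite (le_trans (metric_triangle _ (u (maxn m n)) _))// lerD ?(ltW pm)//.
exact/udist/leq_maxr.
Qed.

Lemma ldistBl (R : realType) (Y : linearMetricType R) (y u v : Y) :
  (forall u v z : Y, ldist (u + z) (v + z) = ldist u v) ->
  ldist (y - u) (y - v) = ldist u v.
Proof.
(* Translating the left pair by [u] and the right pair by [y - v] gives the same two points, [y] and
   [y - v + u], in opposite order. *)
move=> inv; rewrite -(inv (y - u) (y - v) u) -(inv u v (y - v)).
by rewrite subrK (addrC v) subrK (addrC u) ldist_sym.
Qed.

Lemma dist_set_map_add (R : realType) (X : Type) (Y : linearMetricType R)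
    (F : X -> set Y) (g : X -> Y) (x : X) (y : Y) :
  (forall u v z : Y, ldist (u + z) (v + z) = ldist u v) ->
  dist_set ldist y (map_add F g x) = dist_set ldist (y - g x) (F x).
Proof.
move=> inv; congr ereal_inf; rewrite /map_add image_comp.
by apply: eq_imagel => v _ /=; rewrite -(inv (y - g x) v (g x)) subrK.
Qed.

Lemma dist_set_ge0 (R : realType) (Y : linearMetricType R) (y : Y) (A : set Y) :
  (0 <= dist_set ldist y A)%E.
Proof.
apply: le_ereal_inf_tmp => _ [a _ <-]; rewrite lee_fin.
have := ldist_triangle a y y; rewrite ldistxx (ldist_sym a y); lra.
Qed.

Lemma dist_set_le (R : realType) (T : Type) (d : T -> T -> R) (x a : T)
    (A : set T) : A a -> (dist_set d x A <= (d x a)%:E)%E.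
Proof. by move=> Aa; apply: ereal_inf_lbound; exists a. Qed.

Lemma dist_set_lt (R : realType) (T : Type) (d : T -> T -> R) (x : T)
    (A : set T) (e : R) :
  (dist_set d x A < e%:E)%E -> exists2 a, A a & d x a < e.
Proof. by move/ereal_inf_lt => [_ [a Aa <-]]; rewrite lte_fin; exists a. Qed.

(** The graph points [(u n.+1, y - g (u n))] converge to [(p, y - g p)]; the index shift does not
    affect the limit. *)
Lemma closed_graph_cvg (R : realType) (X : topologicalType)
    (Y : linearMetricType R) (F : X -> set Y) (g : X -> Y)
    (u : nat -> X) (p : X) (y : Y) :
  (forall u v z : Y, ldist (u + z) (v + z) = ldist u v) ->
  closed (map_graph F) -> {for p, continuous g} -> u @ \oo --> p ->
  (forall n, F (u n.+1) (y - g (u n))) -> F p (y - g p).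
Proof.
move=> inv Fcl gp up Fu.
have Fnear : \forall n \near \oo, map_graph F (u n.+1, y - g (u n)).
  exact: nearW.
apply: (closed_cvg _ Fcl Fnear (p, y - g p)).
apply: cvg_pair => /=; first last.
  have gu : g \o u @ \oo --> g p by exact: cvg_comp up gp.
  move=> A /nbhs_ldist[e e0 eA].
  have /gu[N _ NA] : nbhs (g p) [set z | ldist (g p) z < e].
    by apply/nbhs_ldist; exists e.
  by exists N => // n /NA /= gn; apply: eA; rewrite /= ldistBl.
by move=> A /up[N _ NA]; exists N => // n /= Nn; apply/NA/leqW.
Qed.

Lemma ereal_between (R : realType) (a b : \bar R) :
  (-oo < a)%E -> (a < b)%E -> exists2 c : R, (a < c%:E)%E & (c%:E < b)%E.
Proof.
case: a b => [a||] [b||] //= _.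
- by rewrite lte_fin => ab; exists ((a + b) / 2); rewrite lte_fin ?midf_lt.
- by move=> _; exists (a + 1); rewrite ?ltry// lte_fin ltrDl.
Qed.

Lemma perturbed_solution (R : realType) (X : completeMetricType R)
    (Y : linearMetricType R) (kappa l kappa' c : R) (Omega : set (X * Y))
    (gamma : X -> \bar R) (F : X -> set Y) (g : X -> Y) (x : X) (y : Y) :
  (forall u v z : Y, ldist (u + z) (v + z) = ldist u v) ->
  0 < kappa -> 0 < l -> 0 < kappa' -> kappa * (1 + kappa' * l) < kappa' ->
  elipschitz1_on mdist (fst @` Omega) gamma ->
  closed (map_graph F) -> continuous g ->
  open_eball mdist x (gamma x) `*` open_eball ldist (y - g x) (l%:E * gamma x)%E
    `<=` Omega ->
  gamma_regular mdist ldist gamma F Omega kappa ->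
  lipschitz_const_on mdist ldist (fst @` Omega) l g ->
  0 < c -> (c%:E < gamma x)%E ->
  (kappa'%:E * dist_set ldist (y - g x)%R (F x) <= c%:E)%E ->
  exists2 p, mdist x p <= c & F p (y - g p).
Proof.
move=> inv k0 l0 k'0 kk' gammalip Fcl gcont WO Freg glip c0 cg Dc.
pose s := 1 + kappa' * l.
have s1 : 1 < s by rewrite ltrDl mulr_gt0.
have s0 : 0 < s by lra.
pose q := kappa' * l / s.
have q0 : 0 < q by rewrite !(divr_gt0, mulr_gt0).
have qE : 1 - q = s^-1.
  have -> : q = (s - 1) / s by rewrite /q /s addrAC subrr add0r.
  by field; rewrite gt_eqF.
have q1 : q < 1 by rewrite -subr_gt0 qE invr_gt0.
have gx0 : (0 < gamma x)%E by rewrite (lt_trans _ cg)// lte_fin.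
have lgx0 : (0 < l%:E * gamma x)%E by rewrite mule_gt0// lte_fin.
(* The second ball has positive radius, so its centre serves as the companion of [v] in [Omega]. *)
have XO v : ((mdist x v)%:E < gamma x)%E -> (fst @` Omega) v.
  move=> xv; exists (v, y - g x) => //; apply: WO; split => /=.
    by rewrite /open_eball /= metric_sym.
  by rewrite /open_eball /= ldistxx.
have xO : (fst @` Omega) x by apply: XO; rewrite mdistxx.
(* Replacing [g x] by [g v] moves the centre by at most [l * mdist x v], which is below the radius
   of the second ball. *)
have O v : ((mdist x v)%:E < gamma x)%E -> Omega (v, y - g v).
  move=> xv; apply: WO; split; rewrite /open_eball /=.
    by rewrite metric_sym.
  rewrite ldistBl//; apply: (@le_lt_trans _ _ (l%:E * (mdist x v)%:E)%E).
    by rewrite -EFinM lee_fin metric_sym; apply: glip => //; exact: XO.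
  by rewrite lte_pmul2l.
(* The step of size [(1 - q) * c * q ^+ n] strictly exceeds
   [kappa * (c / kappa' * q ^+ n)], the distance allowed by regularity. *)
pose good n v := mdist x v + c * q ^+ n <= c /\
  (dist_set ldist (y - g v)%R (F v) <= (c / kappa' * q ^+ n)%:E)%E.
(* In [good], [c * q ^+ n] is the distance that the iteration may still travel. *)
have goodlt n v : mdist x v + c * q ^+ n <= c -> ((mdist x v)%:E < gamma x)%E.
  move=> xv; apply: lt_trans cg; rewrite lte_fin.
  by have := exprn_gt0 n q0; nra.
have good0 : good 0%N x.
  split; first by rewrite mdistxx expr0; lra.
  by rewrite expr0 mulr1 mulrC EFinM lee_pdivlMl.
have step n v : good n v -> exists w, [/\ good n.+1 w, F w (y - g v) &
    mdist v w <= (1 - q) * c * q ^+ n].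
  move=> [xv Dv]; have qn0 := exprn_gt0 n q0.
  have vg := goodlt _ _ xv.
  have kstep : kappa * (c / kappa' * q ^+ n) < (1 - q) * c * q ^+ n.
    rewrite qE mulrA ltr_pM2r// mulrA mulrAC ltr_pM2r//.
    by rewrite ltr_pdivrMr// mulrC ltr_pdivlMr.
  have kD : (kappa%:E * dist_set ldist (y - g v)%R (F v) <=
      (kappa * (c / kappa' * q ^+ n))%:E)%E by rewrite EFinM lee_pmul2l.
  (* The Lipschitz property of [gamma] gives [gamma v > c - mdist x v >= c * q ^+ n], which exceeds
     the step size. *)
  have kg : (kappa%:E * dist_set ldist (y - g v)%R (F v) < gamma v)%E.
    apply: (le_lt_trans kD).
    have : (c%:E < gamma v + (mdist x v)%:E)%E.
      by apply: lt_le_trans cg (gammalip _ _ xO _); exact: XO.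
    rewrite -lteBlDr// -EFinB; apply: le_lt_trans; rewrite lee_fin.
    have : 0 < q * c * q ^+ n by rewrite mulr_gt0// mulr_gt0.
    by move: kstep xv; lra.
  have [w Fw vw] : exists2 w, F w (y - g v) & mdist v w < (1 - q) * c * q ^+ n.
    apply: dist_set_lt; apply: le_lt_trans (Freg _ _ (O _ vg) kg) _.
    by apply: le_lt_trans kD _; rewrite lte_fin.
  have xw : mdist x w + c * q ^+ n.+1 <= c.
    by have := metric_triangle x v w; rewrite exprS; nra.
  exists w; split => //; [split => //|exact: ltW].
  (* Since [y - g v] lies in [F w], the new residual is at most the distance from [g v] to [g w].
     The bound closes because [l * (1 - q) = q / kappa']. *)
  apply: le_trans (dist_set_le _ _ Fw) _; rewrite lee_fin ldistBl//.
  apply: (@le_trans _ _ (l * mdist v w)).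
    by rewrite metric_sym glip//; apply: XO => //; exact: goodlt xw.
  apply: (@le_trans _ _ (l * ((1 - q) * c * q ^+ n))).
    by rewrite ler_pM2l// ltW.
  by rewrite qE exprS {2}/q le_eqVlt; apply/orP; left; apply/eqP; field; lra.
(* The index is paired with the point because the step size depends on it; [x] is a dummy value
   where [good] fails. *)
have /choice[f fP] : forall nv : nat * X, exists w, good nv.1 nv.2 ->
    [/\ good nv.1.+1 w, F w (y - g nv.2) &
      mdist nv.2 w <= (1 - q) * c * q ^+ nv.1].
  move=> -[n v] /=.
  have [/step[w ?]|?] := pselect (good n v); first by exists w.
  by exists x.
pose u := fix u n := if n is m.+1 then f (m, u m) else x.
have gu n : good n (u n).
  by elim: n => [//|n IH] /=; have [] := fP (n, u n) IH.
have [|p up uD] := @geometric_mdist_cvg R X u c q (ltW c0) (ltW q0) q1.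
  by move=> n; have [] := fP (n, u n) (gu n).
exists p; first by have := uD 0%N; rewrite expr0 mulr1.
apply: (closed_graph_cvg inv Fcl (gcont p) up) => n.
by have [] := fP (n, u n) (gu n).
Qed.

Theorem theorem3p8 (R : realType) (X : completeMetricType R)
    (Y : linearMetricType R)
    (transl_inv : forall u v z : Y, ldist (u + z) (v + z) = ldist u v)
    (kappa l : R) (kappa_gt0 : 0 < kappa) (l_gt0 : 0 < l)
    (kappal_lt1 : kappa * l < 1)
    (Omega : set (X * Y)) (Omega_neq0 : Omega !=set0)
    (gamma : X -> \bar R) (gamma_ge0 : forall x, (0 <= gamma x)%E)
    (gamma_gt0 : forall x, (fst @` Omega) x -> (0 < gamma x)%E)
    (gamma_lip : elipschitz1_on mdist (fst @` Omega) gamma)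
    (F : X -> set Y) (F_closed : closed (map_graph F))
    (g : X -> Y) (g_cont : continuous g) :
  let W : set (X * Y) :=
    [set p | open_eball mdist p.1 (gamma p.1)
             `*` open_eball ldist (p.2 - g p.1) (l%:E * gamma p.1)%E
             `<=` Omega] in
  (map_dom F `&` fst @` W) !=set0 ->
  gamma_regular mdist ldist gamma F Omega kappa ->
  lipschitz_const_on mdist ldist (fst @` Omega) l g ->
  forall kappa' : R, kappa / (1 - kappa * l) < kappa' ->
  gamma_regular mdist ldist gamma (map_add F g) W kappa'.
Proof.
move=> W _ Freg glip kappa' kk' x y Wxy.
have kk's : kappa * (1 + kappa' * l) < kappa'.
  by move: kk'; rewrite ltr_pdivrMr ?subr_gt0//; lra.
have k'0 : 0 < kappa'.
  by apply: lt_trans kk'; rewrite divr_gt0// subr_gt0.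
rewrite dist_set_map_add// => Dg; rewrite leNgt; apply/negP => DX.
set D := dist_set ldist _ _ in Dg DX.
have D0 : (0 <= kappa'%:E * D)%E by rewrite mule_ge0 ?dist_set_ge0 ?lee_fin ?ltW.
(* If the estimate failed, some real [c] above [kappa' * D] would lie below both [gamma x] and the
   distance to the preimage; a solution within [c] of [x] contradicts the latter. *)
have [c Dc cm] : exists2 c : R, (kappa'%:E * D < c%:E)%E &
    (c%:E < Order.min (gamma x) (dist_set mdist x (map_inv (map_add F g) y)))%E.
  apply: ereal_between; first exact: lt_le_trans D0.
  by rewrite lt_min Dg.
move: cm; rewrite lt_min => /andP[cg cX].
have c0 : 0 < c by rewrite -lte_fin; exact: le_lt_trans D0 Dc.
have [p xp Fp] := perturbed_solution transl_inv kappa_gt0 l_gt0 k'0 kk's gamma_lip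
  F_closed g_cont Wxy Freg glip c0 cg (ltW Dc).
move: cX; rewrite ltNge => /negP; apply.
apply: (@le_trans _ _ (mdist x p)%:E); last by rewrite lee_fin.
by apply: dist_set_le; exists (y - g p) => //; rewrite subrK.
Qed.
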